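(* If $r \ge 3$ and $\ell \ge 10$ are integers, then there is a rank-$r$ matroid $M \in \mathcal{U}(\ell)$ having at least $(2^{-7}\ell^3)^{(r-2)/2}$ hyperplanes.
   Context: Matroids are finite. $U_{2,n}$ denotes the rank-$2$ uniform matroid on $n$ elements. $\mathcal{U}(\ell)$ denotes the class of matroids with no minor isomorphic to $U_{2,\ell+2}$. A hyperplane of a rank-$r$ matroid is a flat of rank $r-1$. *)

(* Defs.v *)
From mathcomp Require Import all_boot.

Set Implicit Arguments.
Unset Strict Implicit.
Unset Printing Implicit Defensive.

(* A finite matroid whose ground set is all of T, given by its rank function. *)
Record matroid (T : finType) := Matroid {
  rk :> {set T} -> nat;
  rk_card : forall A : {set T}, rk A <= #|A|;
  rk_mono : forall A B : {set T}, A \subset B -> rk A <= rk B;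
  rk_submod : forall A B : {set T}, rk (A :|: B) + rk (A :&: B) <= rk A + rk B
}.

Definition rank (T : finType) (M : matroid T) : nat := rk M [set: T].

Definition closure (T : finType) (M : matroid T) (A : {set T}) : {set T} :=
  [set x | rk M (x |: A) == rk M A].

Definition flat (T : finType) (M : matroid T) (F : {set T}) : bool :=
  closure M F == F.

(* The successor avoids truncated subtraction: rank-0 matroids have no
   hyperplane. *)
Definition hyperplane (T : finType) (M : matroid T) (H : {set T}) : bool :=
  flat M H && ((rk M H).+1 == rank M).

Definition hyperplanes (T : finType) (M : matroid T) : {set {set T}} :=
  [set H | hyperplane M H].

Section Minor.
Variables (T : finType) (M : matroid T) (C D : {set T}).

Definition minor_rk (X : {set {x : T | x \notin C :|: D}}) : nat :=
  rk M ([set val x | x in X] :|: C) - rk M C.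

Let rkC A : rk M C <= rk M (A :|: C).
Proof. exact/rk_mono/subsetUr. Qed.

Lemma minor_rk_card X : minor_rk X <= #|X|.
Proof.
rewrite leq_subLR -(card_imset (mem X) val_inj) addnC.
apply: leq_trans (leq_add (rk_card M _) (leqnn _)).
exact: leq_trans (leq_addr _ _) (rk_submod M _ _).
Qed.

Lemma minor_rk_mono (X Y : {set {x : T | x \notin C :|: D}}) :
  X \subset Y -> minor_rk X <= minor_rk Y.
Proof. by move=> XY; apply/leq_sub2r/rk_mono/setSU/imsetS. Qed.

Lemma minor_rk_submod (X Y : {set {x : T | x \notin C :|: D}}) :
  minor_rk (X :|: Y) + minor_rk (X :&: Y) <= minor_rk X + minor_rk Y.
Proof.
rewrite /minor_rk imsetU imsetI; last by move=> x y _ _; apply: val_inj.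
set A := imset _ _; set B := imset _ _.
have subK (W : {set T}) : rk M (W :|: C) - rk M C + rk M C = rk M (W :|: C).
  by rewrite subnK.
rewrite -(leq_add2r (rk M C + rk M C)).
rewrite (addnACA _ _ (rk M C)) (addnACA _ (rk M (B :|: C) - _)) !subK.
by rewrite setUUl setUIl; apply: rk_submod.
Qed.

(* The minor M / C \ D, with ground set T minus C and D. *)
Definition minor : matroid {x : T | x \notin C :|: D} :=
  Matroid minor_rk_card minor_rk_mono minor_rk_submod.

End Minor.

Definition isomorphic (S T : finType) (M : matroid S) (N : matroid T) : Prop :=
  exists2 f : S -> T,
    bijective f & forall X : {set S}, rk N [set f x | x in X] = rk M X.

Definition has_minor (S T : finType) (M : matroid T) (N : matroid S) : Prop :=
  exists C D : {set T}, [disjoint C & D] /\ isomorphic (minor M C D) N.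

Section Uniform.
Variables k n : nat.

Definition uniform_rk (A : {set 'I_n}) : nat := minn #|A| k.

Lemma uniform_rk_card A : uniform_rk A <= #|A|.
Proof. exact: geq_minl. Qed.

Lemma uniform_rk_mono (A B : {set 'I_n}) :
  A \subset B -> uniform_rk A <= uniform_rk B.
Proof.
move=> /subset_leq_card AB.
by rewrite leq_min geq_minr andbT (leq_trans (geq_minl _ _) AB).
Qed.

Lemma uniform_rk_submod (A B : {set 'I_n}) :
  uniform_rk (A :|: B) + uniform_rk (A :&: B) <= uniform_rk A + uniform_rk B.
Proof.
rewrite /uniform_rk; have := cardsUI A B.
have := subset_leq_card (subsetIl A B); have := subset_leq_card (subsetIr A B).
move: #|A| #|B| #|A :|: B| #|A :&: B| => a b u i ib ia uab.
case: (leqP a k) => ak.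
  case: (leqP b k) => bk; first by rewrite -uab leq_add ?geq_minl.
  by rewrite addnC leq_add ?geq_minr // (leq_trans (geq_minl _ _)).
by rewrite leq_add ?geq_minr // leq_min geq_minr (leq_trans (geq_minl _ _)).
Qed.

Definition uniform : matroid 'I_n :=
  Matroid uniform_rk_card uniform_rk_mono uniform_rk_submod.

End Uniform.

(* Membership in the class U(l). *)
Definition in_U (l : nat) (T : finType) (M : matroid T) : Prop :=
  ~ has_minor M (uniform 2 (l + 2)).

(* Main.v *)
(* Take the affine plane over the field with q elements, add the point at
   infinity e of the horizontal direction, and replace every vertical line by
   all the pairs of its points.  In this rank-3 matroid each point lies on at
   most 2q - 1 lines, whereas q * 'C(q, 2), about q^3 / 2, lines avoid e.  Glue
   k such planes (and a coloop if r is even) by parallel connection along e and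
   delete e: the rank is 2k + 1 (or 2k + 2), no line of a contraction becomes
   longer, and a hyperplane is obtained by choosing independently in each plane
   a line that avoids e.  With q a power of 2 such that 2q <= l + 2 < 4q, this
   gives at least (2^-7 l^3)^k hyperplanes. *)

Require Import Defs.
From HB Require Import structures.
From mathcomp Require Import all_boot all_order all_algebra.
From mathcomp Require Import reals exp.
From mathcomp Require Import finfield zify.

Set Implicit Arguments.
Unset Strict Implicit.
Unset Printing Implicit Defensive.

(** * Bounds on the lines of contractions, and the class U(l) *)

Section LineBound.
Variable T : finType.

(* Testing only sets [X] of pairwise independent elements of rank at most 2 in
   [M / C] avoids simplifying minors. *)
Definition line_bounded n (M : matroid T) := forall C X : {set T},
  {in X &, forall x y, x != y -> M C + 2 <= M (x |: (y |: C))} ->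
  M (X :|: C) <= M C + 2 -> #|X| <= n.

Lemma rk_add1 (M : matroid T) x A : M (x |: A) <= (M A).+1.
Proof.
have := rk_submod M [set x] A; have := rk_card M [set x]; rewrite cards1; lia.
Qed.

Lemma rk_subset_incr (M : matroid T) (A B C : {set T}) :
  A \subset B -> M (C :|: B) + M A <= M (C :|: A) + M B.
Proof.
move=> AB; have := rk_submod M (C :|: A) B.
rewrite -setUA (setUidPr AB).
have := @rk_mono _ M A ((C :|: A) :&: B).
rewrite subsetI subsetUr AB => /(_ isT). lia.
Qed.

(** The ground set of a [U_{2,l+2}] minor [M / C \ D] consists of [l + 2] elements, pairwise
    independent and of total rank 2 in [M / C]. *)
Lemma line_bounded_in_U l (M : matroid T) : line_bounded l.+1 M -> in_U l M.
Proof.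
move=> bM [C [D [_ [f [g fK gK] fE]]]].
have injf := can_inj fK.
pose X := [set val x | x in [set: {x : T | x \notin C :|: D}]].
have MC A : M C <= M (A :|: C) by apply/rk_mono/subsetUr.
have cX : #|X| = l + 2.
  rewrite card_imset; last exact: val_inj.
  rewrite -(card_imset _ injf); rewrite -[RHS]card_ord -cardsT.
  congr #|pred_of_set _|; apply/setP=> i; rewrite !inE.
  by apply/imsetP; exists (g i).
suff : #|X| <= l.+1 by rewrite cX; lia.
apply: (bM C).
  move=> _ _ /imsetP[x _ ->] /imsetP[y _ ->] xy.
  have := fE [set x; y]; rewrite imsetU !imset_set1 /= /uniform_rk cards2.
  rewrite (inj_eq injf) /minor_rk imsetU !imset_set1 -setUA.
  have -> : x != y by apply: contraNneq xy => ->.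
  by have := MC [set val x; val y]; rewrite -setUA /=; lia.
have := fE setT; rewrite /= /uniform_rk /minor_rk -/X.
have := MC X; have := geq_minr #|[set f x | x in setT]| 2; lia.
Qed.

End LineBound.

(** * Contraction of one element *)

Section Contract.
Variables (T : finType) (M : matroid T) (e : T).

(** The ground set stays [T], with [e] turned into a loop, so that ranks before and after
    contraction can be compared on the same sets. *)
Definition contract_rk A := M (e |: A) - M [set e].

Let Me A : M [set e] <= M (e |: A).
Proof. exact/rk_mono/subsetUl. Qed.

Lemma contract_rk_card A : contract_rk A <= #|A|.
Proof.
have := rk_submod M [set e] A; have := rk_card M A; rewrite /contract_rk; lia.
Qed.

Lemma contract_rk_mono (A B : {set T}) :
  A \subset B -> contract_rk A <= contract_rk B.
Proof. by move=> AB; apply/leq_sub2r/rk_mono/setUS. Qed.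

Lemma contract_rk_submod (A B : {set T}) :
  contract_rk (A :|: B) + contract_rk (A :&: B) <= contract_rk A + contract_rk B.
Proof.
have := rk_submod M (e |: A) (e |: B); rewrite -setUUr -setUIr /contract_rk.
by have := (Me A, Me B, Me (A :|: B), Me (A :&: B)) => -[[[]]]; lia.
Qed.

Definition contract : matroid T :=
  Matroid contract_rk_card contract_rk_mono contract_rk_submod.

Lemma contractE A : contract A + M [set e] = M (e |: A).
Proof. exact: subnK. Qed.

Lemma line_bounded_contract n : line_bounded n M -> line_bounded n contract.
Proof.
move=> bM C X pairs; rewrite -(leq_add2r (M [set e])) addnAC !contractE => top.
apply: (bM (e |: C)); last by rewrite setUCA.
move=> x y Xx Xy xy; have := pairs x y Xx Xy xy.
by rewrite -(leq_add2r (M [set e])) addnAC !contractE setUCA (setUCA [set e]).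
Qed.

End Contract.

(* Higgs's elementary lift of the quotient [b] towards [a]. *)
Section Lift.
Variables (T : finType) (a b : matroid T).
Hypothesis quot : forall A B : {set T}, A \subset B -> b B + a A <= b A + a B.

Definition lift_rk A := minn (a A) (b A).+1.

Lemma lift_rk_card A : lift_rk A <= #|A|.
Proof. by apply: leq_trans (rk_card a A); apply: geq_minl. Qed.

Lemma lift_rk_mono (A B : {set T}) : A \subset B -> lift_rk A <= lift_rk B.
Proof.
by move=> AB; have := rk_mono a AB; have := rk_mono b AB; rewrite /lift_rk; lia.
Qed.

(** By [quot], [a - b] is monotone. In the mixed case, with minimum [a] at one set and [b + 1] at
    the other, bound the intersection by [a] and the union by [b + 1]. *)
Lemma lift_rk_submod (A B : {set T}) :
  lift_rk (A :|: B) + lift_rk (A :&: B) <= lift_rk A + lift_rk B.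
Proof.
have := rk_submod a A B; have := rk_submod b A B.
have := quot (subsetIl A B); have := quot (subsetIr A B).
by rewrite /lift_rk; lia.
Qed.

Definition lift : matroid T := Matroid lift_rk_card lift_rk_mono lift_rk_submod.

End Lift.

(** * Direct sums with the tips deleted *)

Section DirectSum.
Variables (J E : finType) (K : J -> matroid (option E)).

(** Each [K j] has a tip [None], but no fiber contains it: on the ground set [J * E] the tips are
    deleted. *)
Definition fiber (A : {set J * E}) (j : J) : {set option E} :=
  [set v | if v is Some y then (j, y) \in A else false].

Lemma fiberU A B j : fiber (A :|: B) j = fiber A j :|: fiber B j.
Proof. by apply/setP=> -[y|]; rewrite !inE. Qed.

Lemma fiberI A B j : fiber (A :&: B) j = fiber A j :&: fiber B j.
Proof. by apply/setP=> -[y|]; rewrite !inE. Qed.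

Lemma fiberS (A B : {set J * E}) j : A \subset B -> fiber A j \subset fiber B j.
Proof. by move/subsetP=> AB; apply/subsetP=> -[y|]; rewrite !inE //; apply: AB. Qed.

Lemma fiber1 j y : fiber [set (j, y)] j = [set Some y].
Proof.
by apply/setP=> -[z|]; rewrite !inE // xpair_eqE eqxx.
Qed.

Lemma fiber1_neq i j y : i != j -> fiber [set (j, y)] i = set0.
Proof. by move=> ij; apply/setP=> -[z|]; rewrite !inE // xpair_eqE (negPf ij). Qed.

Lemma card_fiber A : \sum_j #|fiber A j| = #|A|.
Proof.
rewrite -sum1_card (partition_big fst xpredT) //=; apply: eq_bigr => j _.
have -> : fiber A j = [set Some x.2 | x in [set x in A | x.1 == j]].
  apply/setP=> v; apply/idP/imsetP => [|[[i y]]].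
    by case: v => [y|]; rewrite inE // => Ay; exists (j, y); rewrite // inE Ay /=.
  by rewrite !inE /= => /andP[Ay /eqP ij] ->; rewrite -ij.
rewrite card_in_imset => [|[i y] [i' y']]; last first.
  by rewrite !inE /= => /andP[_ /eqP->] /andP[_ /eqP->] [->].
by rewrite -sum1_card; apply: eq_bigl => x; rewrite inE.
Qed.

Definition dsum_rk A := \sum_j K j (fiber A j).

Lemma dsum_rk_card A : dsum_rk A <= #|A|.
Proof. by rewrite -card_fiber; apply: leq_sum => j _; apply: rk_card. Qed.

Lemma dsum_rk_mono (A B : {set J * E}) : A \subset B -> dsum_rk A <= dsum_rk B.
Proof. by move=> AB; apply: leq_sum => j _; apply/rk_mono/fiberS. Qed.

Lemma dsum_rk_submod A B :
  dsum_rk (A :|: B) + dsum_rk (A :&: B) <= dsum_rk A + dsum_rk B.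
Proof.
rewrite -!big_split; apply: leq_sum => j _; rewrite fiberU fiberI.
exact: rk_submod.
Qed.

Definition dsum :=
  Matroid dsum_rk_card dsum_rk_mono dsum_rk_submod.

Lemma dsumD1 A j :
  dsum A = K j (fiber A j) + \sum_(i | i != j) K i (fiber A i).
Proof. exact: bigD1. Qed.

Lemma dsum_incr1 (A B : {set J * E}) j : A \subset B ->
  K j (fiber B j) + dsum A <= K j (fiber A j) + dsum B.
Proof.
move=> AB; rewrite !(dsumD1 _ j).
suff : \sum_(i | i != j) K i (fiber A i) <= \sum_(i | i != j) K i (fiber B i).
  by lia.
by apply: leq_sum => i _; apply/rk_mono/fiberS.
Qed.

(** Used to show that, if the total rank grows by at most 1, two different summands cannot both
    grow. *)
Lemma dsum_incr2 (A B : {set J * E}) i j : A \subset B -> i != j ->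
  K i (fiber B i) + K j (fiber B j) + dsum A <=
  K i (fiber A i) + K j (fiber A j) + dsum B.
Proof.
move=> AB ij; rewrite !(dsumD1 _ i) !(bigD1 (P := fun k => k != i) j) /=; last first.
- by rewrite eq_sym.
- by rewrite eq_sym.
set sA := \sum_(_ | _) _; set sB := \sum_(_ | _) _.
suff : sA <= sB by lia.
by apply: leq_sum => k _; apply/rk_mono/fiberS.
Qed.

Lemma dsum_local (A B : {set J * E}) j : (forall x, x \in B -> x.1 = j) ->
  dsum (B :|: A) + K j (fiber A j) = dsum A + K j (fiber (B :|: A) j).
Proof.
move=> Bj; rewrite !(dsumD1 _ j).
suff -> : \sum_(i | i != j) K i (fiber (B :|: A) i) =
          \sum_(i | i != j) K i (fiber A i) by lia.
apply: eq_bigr => i ij; congr (K i _); rewrite fiberU.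
suff -> : fiber B i = set0 by rewrite set0U.
apply/setP=> -[y|]; rewrite !inE //; apply: contraNF ij.
by move=> /Bj /= ->.
Qed.

Lemma dsum_add1 (A : {set J * E}) x :
  dsum (x |: A) + K x.1 (fiber A x.1) = dsum A + K x.1 (fiber (x |: A) x.1).
Proof. by apply: dsum_local => y /set1P->. Qed.

Lemma fiber_same (X : {set J * E}) j : (forall x, x \in X -> x.1 = j) ->
  #|fiber X j| = #|X|.
Proof.
move=> Xj; rewrite -card_fiber (bigD1 j) //= big1 ?addn0 // => i ij.
apply/eqP; rewrite cards_eq0; apply/eqP/setP=> -[y|]; rewrite !inE //.
by apply: contraNF ij => /Xj /= ->.
Qed.

(** Three points of a line of the contraction lie in one summand, so the bound there applies;
    [2 <= n] covers smaller sets. *)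
Lemma line_bounded_dsum n : 2 <= n ->
  (forall j, line_bounded n (K j)) -> line_bounded n dsum.
Proof.
move=> n2 bK C X pairs top.
case: (leqP #|X| 2) => [|X3]; first by move/leq_trans; apply.
have sing x : x \in X -> dsum C < dsum (x |: C).
  move=> Xx; have /card_gt0P[y] : 0 < #|X :\ x| by rewrite (cardsD1 x) Xx in X3; lia.
  rewrite !inE => /andP[yx Xy].
  by have := pairs y x Xy Xx yx; have := rk_add1 dsum y (x |: C); lia.
have nonloop x : x \in X -> K x.1 (fiber C x.1) < K x.1 (fiber (x |: C) x.1).
  move=> Xx; have := sing x Xx; have := dsum_add1 C x; lia.
(* If neither [y] nor [z] is in the summand of [x], then [x] still adds 1 to the rank of [y], [z]
   and [C], which exceeds [top]. *)
have apart x y z : x \in X -> y \in X -> z \in X -> y != z ->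
    x.1 != y.1 -> x.1 != z.1 -> False.
  move=> Xx Xy Xz yz xy xz.
  have eqC : fiber (y |: (z |: C)) x.1 = fiber C x.1.
    rewrite !fiberU (surjective_pairing y) (surjective_pairing z).
    by rewrite !fiber1_neq // !set0U.
  have := dsum_add1 (y |: (z |: C)) x; rewrite (fiberU [set x]) eqC -fiberU.
  have := pairs y z Xy Xz yz; have := nonloop x Xx.
  have : dsum (x |: (y |: (z |: C))) <= dsum (X :|: C).
    by apply: rk_mono; rewrite !setUA setSU // !subUset !sub1set Xx Xy.
  lia.
have same x y : x \in X -> y \in X -> x.1 = y.1.
  move=> Xx Xy; apply/eqP/negPn/negP => xy.
  (* A third point [z] shares its summand with at most one of [x] and [y]; the other one is then
     [apart]. *)
  have : 0 < #|X :\ x :\ y|.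
    by move: X3; rewrite (cardsD1 x) (cardsD1 y) Xx; lia.
  case/card_gt0P=> z; rewrite !inE => /and3P[zy zx Xz].
  have [zx1|zx1] := eqVneq z.1 x.1.
    by apply: (apart y x z) => //; rewrite 1?eq_sym // zx1.
  by apply: (apart x y z) => //; rewrite 1?eq_sym.
have /card_gt0P[x0 Xx0] : 0 < #|X| by lia.
pose j := x0.1; have Xj x : x \in X -> x.1 = j by move/same; apply.
rewrite -(fiber_same Xj); apply: (bK j (fiber C j)).
  move=> [y|] [z|]; rewrite !inE // => Xy Xz yz.
  have := pairs (j, y) (j, z) Xy Xz; rewrite xpair_eqE eqxx => /(_ yz).
  have yzj x : x \in [set (j, y); (j, z)] -> x.1 = j by case/set2P=> ->.
  have := dsum_local C yzj; rewrite !fiberU !fiber1 -!setUA /reverse_coercion; lia.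
by have := dsum_local C Xj; rewrite -fiberU; lia.
Qed.

End DirectSum.

(** * Parallel connection along the tip, its lines and hyperplanes *)

Section ParallelConnection.
Variables (J E : finType) (N : J -> matroid (option E)).
Hypothesis N_tip : forall j, N j [set None] = 1.

Definition tip_rk j : matroid (option E) := contract (N j) None.

Lemma tip_rkE j A : (tip_rk j A).+1 = N j (None |: A).
Proof. by rewrite -addn1 -(N_tip j) contractE. Qed.

(** In each summand, contracting the tip gives a quotient, by [rk_subset_incr]; the inequalities add
    up to what [lift] requires. *)
Lemma tip_rk_quot (A B : {set J * E}) : A \subset B ->
  dsum tip_rk B + dsum N A <= dsum tip_rk A + dsum N B.
Proof.
move=> AB; rewrite -!big_split; apply: leq_sum => j _.
have := rk_subset_incr (N j) [set None] (fiberS j AB).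
by rewrite -!tip_rkE !addSn ltnS.
Qed.

(* The parallel connection of the [N j] along their common element [None],
   with that element then deleted. *)
Definition parallel := lift tip_rk_quot.

Lemma parallelE A : parallel A = minn (dsum N A) (dsum tip_rk A).+1.
Proof. by []. Qed.

Lemma line_bounded_parallel n : 2 <= n ->
  (forall j, line_bounded n (N j)) -> line_bounded n parallel.
Proof.
move=> n2 bN C X pairs top.
have bT j : line_bounded n (tip_rk j) by apply: line_bounded_contract.
have sC Y : C \subset Y :|: C by apply: subsetUr.
have quotC Y := tip_rk_quot (sC Y).
(* Three cases: the tip lies in the closure of [C]; it is not in that of
   [X :|: C]; or it lies on the line [X] of the contraction by [C]. *)
have [Ctip|Cfree] := ltnP (dsum tip_rk C) (dsum N C).
  (* By [quotC] the gap persists above [C], so the rank there is [dsum tip_rk] plus 1. *)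
  apply: (line_bounded_dsum n2 bT (C := C)); last first.
    by move: top (quotC X); rewrite !parallelE; lia.
  move=> x y Xx Xy xy; have := pairs x y Xx Xy xy.
  by have := quotC [set x; y]; rewrite !parallelE -setUA; lia.
have [Xfree|Xtip] := leqP (dsum N (X :|: C)) (dsum N C + 2).
  apply: (line_bounded_dsum n2 bN (C := C)) => // x y Xx Xy xy.
  by have := pairs x y Xx Xy xy; rewrite !parallelE; lia.
(* The minimum at [X :|: C] is now the tip term, so [X] has rank at most 1 once both [C] and the tip
   are contracted. *)
have topT : dsum tip_rk (X :|: C) <= (dsum tip_rk C).+1.
  by move: top; rewrite !parallelE; lia.
have tipC : dsum tip_rk C = dsum N C.
  have : dsum tip_rk C <= dsum N C.
    apply: leq_sum => j _; rewrite -ltnS tip_rkE; exact: rk_add1.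
  lia.
have tip_le j A : tip_rk j A <= N j A by rewrite -ltnS tip_rkE; apply: rk_add1.
(* Termwise inequalities with equal sums are equalities. *)
have tipCj j : tip_rk j (fiber C j) = N j (fiber C j).
  move: tipC (tip_le j (fiber C j)); rewrite (dsumD1 tip_rk C j) (dsumD1 N C j).
  have : \sum_(i | i != j) tip_rk i (fiber C i) <= \sum_(i | i != j) N i (fiber C i).
    by apply: leq_sum => i _; apply: tip_le.
  by lia.
(* At most one point of [X] is parallel to the tip once [C] is contracted; the
   others lie in a single [N j], where the tip extends them to a line. *)
pose Y := [set x in X | dsum tip_rk C < dsum tip_rk (x |: C)].
have cXY : #|X| <= #|Y|.+1.
  rewrite -(cardsID Y X) -addn1 leq_add ?subset_leq_card ?subsetIr //.
  apply/card_le1_eqP => x y; rewrite !inE => /andP[/nandP nYx Xx] /andP[/nandP nYy Xy].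
  apply/esym/eqP/negPn/negP => xy; have := pairs x y Xx Xy xy.
  rewrite Xx in nYx; rewrite Xy in nYy; case: nYx nYy => // nx [] // ny.
  have := rk_subset_incr (dsum tip_rk) [set x] (subsetUr [set y] C).
  by rewrite !parallelE; lia.
apply: leq_trans cXY _.
have YX x : x \in Y -> x \in X by rewrite inE => /andP[].
have nonloop x : x \in Y -> tip_rk x.1 (fiber C x.1) < tip_rk x.1 (fiber (X :|: C) x.1).
  rewrite inE => /andP[Xx lt_x].
  have := dsum_add1 tip_rk C x.
  have : tip_rk x.1 (fiber (x |: C) x.1) <= tip_rk x.1 (fiber (X :|: C) x.1).
    by apply/rk_mono/fiberS/setSU; rewrite sub1set.
  by lia.
case: (set_0Vmem Y) => [->|[x0 Yx0]]; first by rewrite cards0; lia.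
pose j := x0.1.
have Yj x : x \in Y -> x.1 = j.
  move=> Yx; apply/eqP/negPn/negP => xj.
  have := dsum_incr2 tip_rk (sC X) xj; have := nonloop x Yx; have := nonloop x0 Yx0.
  by rewrite -/j; lia.
(* The tip stands in for the point of [X] that may be missing from [Y], so the bound [n] is not
   weakened. *)
have -> : #|Y|.+1 = #|None |: fiber Y j|.
  by rewrite cardsU1 inE fiber_same.
apply: (bN j (fiber C j)); last first.
  rewrite -setUA -fiberU -tip_rkE -tipCj addn2 !ltnS.
  have := dsum_incr1 tip_rk j (sC X).
  have : tip_rk j (fiber (Y :|: C) j) <= tip_rk j (fiber (X :|: C) j).
    by apply/rk_mono/fiberS/setSU/subsetP.
  by lia.
have tip_pair y : (j, y) \in Y -> N j (fiber C j) + 2 <= N j (None |: (Some y |: fiber C j)).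
  move=> Yy; rewrite -tip_rkE -tipCj -(fiber1 j) -fiberU addn2 ltnS.
  have := dsum_add1 tip_rk C (j, y).
  by move: Yy; rewrite inE => /andP[_]; rewrite /reverse_coercion /fst; lia.
clearbody Y; move=> [y|] [z|]; rewrite !inE //= => Yy Yz yz.
- have Xy := YX _ Yy; have Xz := YX _ Yz.
  have := pairs (j, y) (j, z) Xy Xz; rewrite xpair_eqE eqxx => /(_ yz).
  rewrite setUA; have yzj x : x \in [set (j, y); (j, z)] -> x.1 = j by case/set2P=> ->.
  have := dsum_local N C yzj; rewrite !fiberU !fiber1 -!setUA !parallelE.
  by move: tipC; rewrite /reverse_coercion; lia.
- by rewrite setUCA; apply: tip_pair.
- exact: tip_pair.
Qed.

Variable d : J -> nat.
Hypothesis N_rank : forall j, rank (N j) = (d j).+1.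
Hypothesis d_lt : \sum_j d j < \sum_j N j [set~ None].

(** By [d_lt], the minimum at the full set is the tip term: deleting the tip does not lower the
    rank. *)
Lemma rank_parallel : rank parallel = (\sum_j d j).+1.
Proof.
rewrite /rank parallelE.
have fT j : fiber [set: J * E] j = [set~ None] by apply/setP=> -[y|]; rewrite !inE.
have -> : dsum N setT = \sum_j N j [set~ None] by apply: eq_bigr => j _; rewrite fT.
have -> : dsum tip_rk setT = \sum_j d j.
  apply: eq_bigr => j _; apply: succn_inj.
  by rewrite fT tip_rkE setUCr; apply: N_rank.
exact/minn_idPr.
Qed.

(** The fibers are hyperplanes of the [N j] avoiding the tip. Taking [v] to be the tip shows that
    both direct sums have rank [\sum_j d j] on [A]; a new element raises the first, so it raises the
    minimum. *)
Lemma hyperplane_parallel A :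
  (forall j, N j (fiber A j) = d j) ->
  (forall j v, v \notin fiber A j -> N j (v |: fiber A j) = (d j).+1) ->
  hyperplane parallel A.
Proof.
move=> dA spanA.
have sN : dsum N A = \sum_j d j by apply: eq_bigr => j _; rewrite dA.
have sT : dsum tip_rk A = \sum_j d j.
  apply: eq_bigr => j _; apply: succn_inj.
  by rewrite tip_rkE spanA // inE.
have pA : parallel A = \sum_j d j by rewrite parallelE sN sT; lia.
rewrite /hyperplane rank_parallel pA eqxx andbT.
apply/eqP/setP=> x; rewrite inE; have [Ax|nAx] := boolP (x \in A).
  by rewrite (setUidPr _) ?sub1set ?eqxx.
apply/negbTE; rewrite pA parallelE neq_ltn.
have := dsum_add1 N A x; rewrite sN dA fiberU; case: x nAx => j y nAx.
rewrite fiber1 spanA ?inE // => sNx.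
have : dsum tip_rk A <= dsum tip_rk ((j, y) |: A) by apply/rk_mono/subsetUr.
by rewrite sT; move: sNx; rewrite /reverse_coercion /=; lia.
Qed.

End ParallelConnection.

(** * Matroids of coloops and loops *)

Section FreeOn.
Variables (T : finType) (S : {set T}).

Definition free_rk (A : {set T}) := #|A :&: S|.

Lemma free_rk_card A : free_rk A <= #|A|.
Proof. exact/subset_leq_card/subsetIl. Qed.

Lemma free_rk_mono (A B : {set T}) : A \subset B -> free_rk A <= free_rk B.
Proof. by move=> AB; apply/subset_leq_card/setSI. Qed.

Lemma free_rk_submod A B :
  free_rk (A :|: B) + free_rk (A :&: B) <= free_rk A + free_rk B.
Proof. by rewrite /free_rk setIUl setIIl cardsUI. Qed.

Definition free_on := Matroid free_rk_card free_rk_mono free_rk_submod.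

(** If [X] has more than two elements, [pairs] forces them to be coloops outside [C]; they then
    raise the rank by [#|X|]. *)
Lemma line_bounded_free_on n : 2 <= n -> line_bounded n free_on.
Proof.
move=> n2 C X pairs; have [|X2] := leqP #|X| n; first by [].
have indep x : x \in X -> x \in S :\: C.
  move=> Xx; have /card_gt0P[y] : 0 < #|X :\ x| by move: X2; rewrite (cardsD1 x) Xx; lia.
  rewrite !inE => /andP[yx Xy]; have := pairs y x Xy Xx yx.
  have := rk_add1 free_on y (x |: C) => up low.
  apply/negPn/negP; rewrite negb_and negbK => xSC; move: up low.
  suff -> : free_on (x |: C) = free_on C by lia.
  congr #|pred_of_set _|; apply/setP=> z; rewrite !inE; case: eqP => // ->.
  by case/orP: xSC => [->|/negPf->]; rewrite ?andbF.
rewrite /= /free_rk => top; suff : #|X| + #|C :&: S| <= #|(X :|: C) :&: S| by lia.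
have <- : #|X :|: (C :&: S)| = #|X| + #|C :&: S|.
  rewrite cardsU (_ : X :&: _ = set0) ?cards0 ?subn0 //.
  apply/setP=> z; rewrite !inE; apply/negbTE; apply/negP => /and3P[/indep].
  by rewrite inE => /andP[/negP].
apply/subset_leq_card/subsetP=> z; rewrite !inE => /orP[Xz|/andP[-> ->]]; last by rewrite orbT.
by rewrite Xz; have := indep z Xz; rewrite inE => /andP[].
Qed.

End FreeOn.

(** * The rank-3 matroid of a family of lines meeting pairwise in at most one point *)

Section Linear.
Variables (V K : finType) (L : K -> {set V}).
Hypothesis L_meet : forall k k' v w, v != w ->
  v \in L k -> w \in L k -> v \in L k' -> w \in L k' -> k = k'.

Definition collinear (A : {set V}) := [exists k, A \subset L k].

Lemma collinearP (A : {set V}) : reflect (exists k, A \subset L k) (collinear A).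
Proof. exact: existsP. Qed.

Lemma collinearS (A B : {set V}) : A \subset B -> collinear B -> collinear A.
Proof.
by move=> AB /collinearP[k BL]; apply/collinearP; exists k; apply: subset_trans BL.
Qed.

Lemma collinearU (A B : {set V}) : collinear A -> collinear B -> 1 < #|A :&: B| ->
  collinear (A :|: B).
Proof.
move=> /collinearP[k /subsetP AL] /collinearP[k' /subsetP BL].
case/card_gt1P=> v [w [/setIP[Av Bv] /setIP[Aw Bw] vw]].
apply/collinearP; exists k; rewrite subUset; apply/andP; split; apply/subsetP => //.
by rewrite (L_meet vw (AL _ Av) (AL _ Aw) (BL _ Bv) (BL _ Bw)).
Qed.

(* Rank at most 3, where a pair of points on no common line is also a line. *)
Definition plane_rk (A : {set V}) := minn #|A| (3 - collinear A).

Lemma plane_rk_card (A : {set V}) : plane_rk A <= #|A|.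
Proof. exact: geq_minl. Qed.

Lemma plane_rk_mono (A B : {set V}) : A \subset B -> plane_rk A <= plane_rk B.
Proof.
move=> AB; have := subset_leq_card AB; have := collinearS AB.
rewrite /plane_rk; case: (collinear A); case: (collinear B); lia.
Qed.

Lemma plane_rk_noncollinear (A : {set V}) :
  2 < #|A| -> ~~ collinear A -> plane_rk A = 3.
Proof. by rewrite /plane_rk => ? /negPf->; lia. Qed.

(** The rank depends only on size and collinearity. [L_meet] enters through [collinearU], and [eqA],
    [eqB] treat nested sets; the rest is arithmetic. *)
Lemma plane_rk_submod (A B : {set V}) :
  plane_rk (A :|: B) + plane_rk (A :&: B) <= plane_rk A + plane_rk B.
Proof.
have cI := cardsUI A B.
have iA := subset_leq_card (subsetIl A B); have iB := subset_leq_card (subsetIr A B).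
have cUA := collinearS (subsetUl A B); have cUB := collinearS (subsetUr A B).
have cIA := collinearS (subsetIl A B); have cIB := collinearS (subsetIr A B).
have cU := @collinearU A B.
have eqA : #|A :&: B| = #|A| -> collinear (A :|: B) = collinear B.
  move=> eq_c; congr collinear; apply/setUidPr/setIidPl/eqP.
  by rewrite eqEcard subsetIl eq_c /=.
have eqB : #|A :&: B| = #|B| -> collinear (A :|: B) = collinear A.
  move=> eq_c; congr collinear; apply/setUidPl/setIidPr/eqP.
  by rewrite eqEcard subsetIr eq_c /=.
move: cI iA iB cUA cUB cIA cIB cU eqA eqB; rewrite /plane_rk.
case: (collinear A); case: (collinear B); case: (collinear (A :|: B));
  case: (collinear (A :&: B)) => // cI iA iB cUA cUB cIA cIB cU eqA eqB; lia.
Qed.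

Definition plane := Matroid plane_rk_card plane_rk_mono plane_rk_submod.

(** Only a [C] of size at most 1 leaves rank 2 above it. For empty [C], [X] is a pair or lies in
    some [L k]; for a point [p], the elements of [X] lie on distinct lines through [p]. *)
Lemma line_bounded_plane n : 2 <= n -> (forall k, #|L k| <= n) ->
  (forall p (X : {set V}), p \notin X ->
    {in X &, forall x y, x != y -> ~~ collinear [set x; y; p]} -> #|X| <= n) ->
  line_bounded n plane.
Proof.
move=> n2 L_n pencil_n C X pairs top.
have [X1|X2] := leqP #|X| 1; first by apply: leq_trans X1 _; apply: ltnW.
have C1 : #|C| <= 1.
  have [x [y [Xx Xy xy]]] := card_gt1P X2.
  have := pairs x y Xx Xy xy; rewrite /= /plane_rk.
  by case: (collinear C); lia.
have [C0|[p Cp]] := set_0Vmem C.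
  move: top; rewrite C0 setU0 /= /plane_rk cards0.
  have [/collinearP[k /subset_leq_card XL]|_] := boolP (collinear X); last by lia.
  by move=> _; apply: leq_trans XL (L_n k).
have {Cp} Cp : C = [set p].
  by apply/esym/eqP; rewrite eqEcard sub1set Cp cards1.
rewrite Cp {C C1 top Cp} in pairs.
have rk3 x y : x \in X -> y \in X -> x != y ->
    2 < #|[set x; y; p]| /\ ~~ collinear [set x; y; p].
  move=> Xx Xy xy; have := pairs x y Xx Xy xy; rewrite setUA /= /plane_rk cards1.
  by case: (collinear [set p]); case: (collinear [set x; y; p]); lia.
apply: (pencil_n p) => [|x y Xx Xy xy]; last by have [] := rk3 x y Xx Xy xy.
apply/negP => Xp; have /card_gt0P[y] : 0 < #|X :\ p|.
  by move: X2; rewrite (cardsD1 p) Xp; lia.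
rewrite !inE => /andP[yp Xy]; have [] := rk3 y p Xy Xp yp.
by rewrite -setUA setUid cards2; case: (_ != _).
Qed.

End Linear.

Lemma sum_option (I : finType) (f : option I -> nat) :
  \sum_j f j = f None + \sum_i f (Some i).
Proof.
rewrite (bigD1 None) //=; congr addn.
rewrite (reindex_omap Some id) //=; first by apply: eq_bigl => i; rewrite eqxx.
by case.
Qed.

(** * The modified affine plane and the count of hyperplanes *)

Section AffinePlane.
Variable F : finFieldType.
Import GRing.Theory.
Local Open Scope ring_scope.

(* There are no vertical lines, so that each pair of points with the same
   abscissa is a line of the plane.  The tip [None] is the horizontal
   direction. *)
Definition affine_line (k : F * F) : {set option (F * F)} :=
  [set v | if v is Some z then z.2 == k.1 * z.1 + k.2 else k.1 == 0].

Lemma affine_lineP (z : F * F) (k : F * F) :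
  reflect (z.2 = k.1 * z.1 + k.2) (Some z \in affine_line k).
Proof. by rewrite inE; apply: eqP. Qed.

Lemma affine_line_tip (k : F * F) : (None \in affine_line k) = (k.1 == 0).
Proof. by rewrite inE. Qed.

Lemma affine_line_slope (z t k : F * F) : z != t ->
  Some z \in affine_line k -> Some t \in affine_line k ->
  z.1 != t.1 /\ k.1 = (z.2 - t.2) / (z.1 - t.1).
Proof.
case: z t => [x y] [x' y'] /= nzt /affine_lineP /= ey /affine_lineP /= ey'.
have nx : x != x' by apply: contraNneq nzt => ex; rewrite ey ey' ex.
split=> //; rewrite ey ey' opprD addrACA subrr addr0 -mulrBr mulfK //.
by rewrite subr_eq0.
Qed.

(** Two points fix the slope, which is 0 if one of them is the tip; an affine point then fixes the
    intercept. *)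
Lemma affine_line_meet (k k' : F * F) v w : v != w ->
  v \in affine_line k -> w \in affine_line k ->
  v \in affine_line k' -> w \in affine_line k' -> k = k'.
Proof.
have int z : Some z \in affine_line k -> Some z \in affine_line k' ->
    k.1 = k'.1 -> k = k'.
  case: k k' => [m c] [m' c'] /affine_lineP /= ez /affine_lineP /= e em.
  by move: e; rewrite ez em => /addrI ->.
case: v w => [z|] [t|] // vw.
- move=> zk tk zk' tk'; have zt : z != t by [].
  have [_ ek] := affine_line_slope zt zk tk.
  have [_ ek'] := affine_line_slope zt zk' tk'.
  by apply: (int z) => //; rewrite ek ek'.
- rewrite !affine_line_tip => zk /eqP k0 zk' /eqP k'0.
  by apply: (int z); rewrite // k0 k'0.
rewrite !affine_line_tip => /eqP k0 tk /eqP k'0 tk'.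
by apply: (int t); rewrite // k0 k'0.
Qed.

Definition affine_plane := plane affine_line_meet.

Lemma card_affine_line k : (#|affine_line k| <= #|F|.+1)%N.
Proof.
pose g (x : option F) : option (F * F) := omap (fun x => (x, k.1 * x + k.2)) x.
have -> : #|F|.+1 = #|{: option F}| by rewrite card_option.
apply: leq_trans (leq_imset_card g _); apply/subset_leq_card/subsetP=> -[z|].
  by move/affine_lineP=> ez; apply/imsetP; exists (Some z.1); rewrite //= -ez -surjective_pairing.
by move=> _; apply/imsetP; exists None.
Qed.

Definition pencil_line (p : F * F) m : F * F := (m, p.2 - m * p.1).

Lemma mem_pencil_line (p z : F * F) m :
  (Some z \in affine_line (pencil_line p m)) = (z.2 - p.2 == m * (z.1 - p.1)).
Proof. by rewrite inE /= addrCA -mulrBr addrC -subr_eq. Qed.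

Lemma pencil_line_base (p : F * F) m : Some p \in affine_line (pencil_line p m).
Proof. by rewrite mem_pencil_line !subrr mulr0. Qed.

Lemma line_bounded_affine_plane n : (#|F|.*2 <= n.+1)%N ->
  line_bounded n affine_plane.
Proof.
have F2 : (1 < #|F|)%N by rewrite (cardD1 0) (cardD1 1) !inE oner_eq0.
move=> n_large; apply: line_bounded_plane => [|k|p X pX noncol]; first by lia.
  by have := card_affine_line k; lia.
have cFF : #|{: F + F}| = #|F|.*2 by rewrite card_sum addnn.
(* Code of the line joining [v] to [p]: [inl] of its slope, or [inr] of the ordinate of [v] in a
   vertical pair; if [p] is the tip, [inl] of the height of a horizontal line. The last [inl 0] is a
   default for [v = p], excluded by [pX]. *)
pose dir v : F + F := if p is Some p' then
    if v is Some z then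
      if z.1 == p'.1 then inr z.2 else inl ((z.2 - p'.2) / (z.1 - p'.1))
    else inl 0
  else if v is Some z then inl z.2 else inl 0.
have dir_inj : {in X &, injective dir}.
  have on_line v w k : v \in X -> w \in X -> v \in affine_line k ->
      w \in affine_line k -> p \in affine_line k -> v = w.
    move=> Xv Xw vk wk pk; apply/eqP/negPn/negP => vw.
    have /negP[] := noncol v w Xv Xw vw; apply/collinearP; exists k.
    by rewrite !subUset !sub1set vk wk.
  rewrite /dir; case: p pX noncol on_line {dir} => [p|] pX _ on_line; last first.
    move=> [z|] [t|] Xz Xt //; try by rewrite ?Xz ?Xt in pX.
    move=> [e]; apply: (on_line _ _ (0, z.2)) => //; rewrite inE /= ?mul0r ?add0r ?e //.
  have slope z : z.1 != p.1 ->
      Some z \in affine_line (pencil_line p ((z.2 - p.2) / (z.1 - p.1))).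
    by move=> zp; rewrite mem_pencil_line divfK // subr_eq0.
  move=> [z|] [t|] Xz Xt //.
  - have [ez|zp] := eqVneq z.1 p.1; have [et|tp] := eqVneq t.1 p.1 => // -[e].
      by rewrite (surjective_pairing z) (surjective_pairing t) ez et e.
    apply: (on_line _ _ _ Xz Xt (slope z zp) _ (pencil_line_base _ _)).
    by rewrite e slope.
  - have [//|zp] := eqVneq z.1 p.1; move=> [e].
    apply: (on_line _ _ _ Xz Xt (slope z zp) _ (pencil_line_base _ _)).
    by rewrite e inE.
  have [//|tp] := eqVneq t.1 p.1; move=> [e].
  apply: (on_line _ _ _ Xz Xt _ (slope t tp) (pencil_line_base _ _)).
  by rewrite -e inE.
rewrite -(card_in_imset dir_inj) -ltnS; apply: leq_trans n_large.
rewrite -cFF -cardsT; apply: proper_card; rewrite properT.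
(* For affine [p] this code would force [v = p]; for the tip no [inr] occurs. Hence at most [2q - 1]
   codes are used. *)
have e : inr (if p is Some p' then p'.2 else 0) \notin dir @: X.
  apply/imsetP=> -[v Xv]; rewrite /dir; case: p pX {noncol dir dir_inj} => [[a b]|] pX.
    case: v Xv => [[x y]|] //= Xv; case: eqP => //= ex [] e.
    by rewrite ex -e (negPf pX) in Xv.
  by case: v Xv.
by apply: contraNneq e => ->; rewrite inE.
Qed.

Lemma vertical_noncollinear (x y y' : F) (A : {set option (F * F)}) : y != y' ->
  Some (x, y) \in A -> Some (x, y') \in A -> ~~ collinear affine_line A.
Proof.
move=> yy' Ay Ay'; apply/negP => /collinearP[k /subsetP AL].
have ne : (x, y) != (x, y') by rewrite xpair_eqE eqxx.
by have [/eqP] := affine_line_slope ne (AL _ Ay) (AL _ Ay').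
Qed.

Lemma rank_affine_plane_no_tip : affine_plane [set~ None] = 3.
Proof.
have ne : 0 != 1 :> F by rewrite eq_sym oner_neq0.
apply: plane_rk_noncollinear; last first.
  by apply: (@vertical_noncollinear 0 0 1); rewrite ?inE.
have F2 : (1 < #|F|)%N by rewrite (cardD1 0) (cardD1 1) !inE oner_eq0.
by rewrite cardsC1 card_option card_prod; apply: leq_trans (leq_mul F2 F2).
Qed.

Lemma rank_affine_plane : rank affine_plane = 3.
Proof.
apply/eqP; rewrite eqn_leq; apply/andP; split; last first.
  by rewrite -rank_affine_plane_no_tip; apply/rk_mono/subsetT.
by rewrite /rank /= /plane_rk; lia.
Qed.

Lemma affine_plane_tip : affine_plane [set None] = 1.
Proof. by rewrite /= /plane_rk cards1; case: (collinear _ _). Qed.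

(** The ordinates form an arbitrary set, so that the sets of size 2, which give lines avoiding the
    tip, are counted by [card_draws]. *)
Definition vertical_pair (p : F * {set F}) : {set option (F * F)} :=
  [set v | if v is Some z then (z.1 == p.1) && (z.2 \in p.2) else false].

Lemma card_vertical_pair (p : F * {set F}) : #|vertical_pair p| = #|p.2|.
Proof.
have -> : vertical_pair p = [set Some (p.1, y) | y in p.2].
  apply/setP=> -[[x y]|]; rewrite inE /=.
    apply/andP/imsetP => [[/eqP-> py]|[y' py' [-> ->]]]; first by exists y.
    by rewrite eqxx.
  by apply/esym/imsetP=> -[].
by rewrite card_imset // => y y' [].
Qed.

Lemma vertical_pair_flat (p : F * {set F}) : #|p.2| = 2 ->
  affine_plane (vertical_pair p) = 2 /\
  forall v, v \notin vertical_pair p -> affine_plane (v |: vertical_pair p) = 3.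
Proof.
move=> p2; split=> [|v nv].
  by rewrite /= /plane_rk card_vertical_pair p2; case: (collinear _ _).
apply: plane_rk_noncollinear; first by rewrite cardsU1 nv card_vertical_pair p2.
have /card_gt1P[y [y' [py py' yy']]] : (1 < #|p.2|)%N by rewrite p2.
by apply: (vertical_noncollinear (x := p.1) yy'); rewrite !inE eqxx ?py ?py' orbT.
Qed.

Lemma vertical_pair_inj (p p' : F * {set F}) : #|p.2| = 2 ->
  vertical_pair p = vertical_pair p' -> p = p'.
Proof.
case: p p' => [x S] [x' S'] /= S2 /setP e.
have e1 y : y \in S -> (x == x') && (y \in S').
  by move=> Sy; have := e (Some (x, y)); rewrite !inE /= eqxx Sy.
have /card_gt1P[y [_ [Sy _ _]]] : (1 < #|S|)%N by rewrite S2.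
have /andP[/eqP xx' _] := e1 y Sy; congr (_, _) => //.
by apply/setP=> z; have := e (Some (x, z)); rewrite !inE /= xx' !eqxx.
Qed.

(* The free piece is {tip, coloop} if [c], and {tip} otherwise; every other
   point of it is a loop. *)
Definition piece (k : nat) (c : bool) (j : option 'I_k) :
    matroid (option (F * F)) :=
  if j is Some _ then affine_plane
  else free_on (None |: (if c then [set Some (0, 0)] else set0)).

Lemma many_hyperplanes (k : nat) (c : bool) (n : nat) : (0 < k)%N -> (#|F|.*2 <= n.+1)%N ->
  exists M : matroid (option 'I_k * (F * F))%type,
    [/\ rank M = (k.*2 + c).+1, line_bounded n M &
        ((#|F| * 'C(#|F|, 2)) ^ k <= #|hyperplanes M|)%N].
Proof.
move=> k0 n_large; set N := @piece k c.
have F2 : (1 < #|F|)%N by rewrite (cardD1 0) (cardD1 1) !inE oner_eq0.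
have cS : #|None |: (if c then [set Some (0, 0) : option (F * F)] else set0)| = c.+1.
  by case: (c); rewrite ?cards2 ?setU0 ?cards1.
have N_tip j : N j [set None] = 1.
  case: j => [i|]; first exact: affine_plane_tip.
  by rewrite /N /= /free_rk (setIidPl _) ?cards1 // sub1set !inE eqxx.
pose d (j : option 'I_k) : nat := if j is Some _ then 2 else c.
have N_rank j : rank (N j) = (d j).+1.
  case: j => [i|]; first exact: rank_affine_plane.
  by rewrite /rank /N /= /free_rk setTI.
have sum_d : (\sum_j d j = k.*2 + c)%N.
  by rewrite sum_option /= sum_nat_const card_ord; lia.
have d_lt : (\sum_j d j < \sum_j N j [set~ None])%N.
  (* Without the tip each plane still has rank 3, against [d = 2]; strictness comes from [0 < k]. *)
  rewrite sum_d sum_option /= (eq_bigr (fun=> 3)); last first.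
    by move=> i _; apply: rank_affine_plane_no_tip.
  rewrite sum_nat_const card_ord.
  suff : (c <= N None [set~ None])%N by rewrite /N /=; lia.
  rewrite /N /= /free_rk; case: (c) => //; apply/card_gt0P; exists (Some (0, 0)).
  by rewrite !inE eqxx.
exists (parallel N_tip); split.
- by rewrite (rank_parallel N_tip N_rank d_lt) sum_d.
- apply: line_bounded_parallel; first by lia.
  case=> [i|]; first by apply: line_bounded_affine_plane.
  by apply: line_bounded_free_on; lia.
pose D := [set p : F * {set F} | #|p.2| == 2].
have cD : #|D| = (#|F| * 'C(#|F|, 2))%N.
  rewrite -card_draws -cardsT -cardsX; congr #|pred_of_set _|.
  by apply/setP=> p; rewrite !inE.
(* A vertical pair in each plane, and everything except the tip in the free piece, where this is the
   hyperplane avoiding the tip. *)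
pose H (f : {ffun 'I_k -> F * {set F}}) : {set option 'I_k * (F * F)} :=
  [set x | if x.1 is Some i then Some x.2 \in vertical_pair (f i) else true].
have fiberH f i : fiber (H f) (Some i) = vertical_pair (f i).
  by apply/setP=> -[z|]; rewrite !inE //= inE.
have fiberH0 f : fiber (H f) None = [set~ None].
  by apply/setP=> -[z|]; rewrite !inE.
have H_inj : {in ffun_on D &, injective H}.
  move=> f g /ffun_onP Df _ e; apply/ffunP => i.
  apply: vertical_pair_inj; first by have := Df i; rewrite inE => /eqP.
  by rewrite -!fiberH e.
rewrite -cD -[k in (_ ^ k)%N]card_ord -card_ffun_on -(card_in_imset H_inj).
apply/subset_leq_card/subsetP=> _ /imsetP[f /ffun_onP Df ->]; rewrite inE.
have f2 i : #|(f i).2| = 2 by have := Df i; rewrite inE => /eqP.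
apply: (hyperplane_parallel N_tip N_rank d_lt).
  case=> [i|]; first by rewrite fiberH; have [] := vertical_pair_flat (f2 i).
  rewrite fiberH0 /N /= /free_rk; apply: succn_inj; rewrite -cS.
  rewrite [in RHS](cardsD1 None) !inE eqxx /= add1n setDE setIC; congr (#|pred_of_set _|.+1).
case=> [i|] v; first by rewrite fiberH; have [_] := vertical_pair_flat (f2 i); apply.
rewrite fiberH0 !inE negbK => /eqP->; rewrite setUCr; exact: (N_rank None).
Qed.

End AffinePlane.

(** * Choice of the field and the final estimate *)

Import Order.TTheory GRing.Theory Num.Theory.
Local Open Scope ring_scope.

(* The order q = 2 ^ a is the power of 2 with 2 q <= l + 2 < 4 q. *)
Lemma field_order_near l : (10 <= l)%N ->
  exists a, [/\ (0 < a)%N, ((2 ^ a).*2 <= l.+2)%N &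
    (l ^ 3 <= 128 * (2 ^ a * 'C(2 ^ a, 2)))%N].
Proof.
move=> l10; have /andP[] := @trunc_log_bounds 2 l.+2 isT isT.
have : (1 < trunc_log 2 l.+2)%N by apply: trunc_log_max => //; lia.
case: (trunc_log 2 l.+2) => // a a0; rewrite !(expnS 2) !mul2n => lo hi.
exists a; split=> //; move: (2 ^ a)%N lo hi => q lo hi.
(* The goal becomes [l ^ 3 <= 64 q^2 (q - 1)], and [l <= 4q - 3] suffices because
   [(4q - 3)^3 <= 64 q^3 - 64 q^2]. *)
have -> : (128 * (q * 'C(q, 2)) = 64 * (q * (q * q.-1)))%N.
  have : (2 * 'C(q, 2) = q * q.-1)%N by rewrite mul_bin_left bin1; lia.
  by move=> <-; lia.
have l4q : (l <= 4 * q - 3)%N by lia.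
apply: (@leq_trans ((4 * q - 3) ^ 3)%N); first by rewrite leq_exp2r.
(* [l >= 10] and [l + 2 < 4q] give [q >= 4]; the substitution removes truncated subtraction. *)
have [p ->] : exists p, q = p.+4 by exists (q - 4)%N; lia.
have -> : (4 * p.+4 - 3 = 4 * p + 13)%N by lia.
rewrite !expnS expn0 /=; nia.
Qed.

Theorem corollary3p3 (R : realType) (r l : nat)
  (hr : (3 <= r)%N) (hl : (10 <= l)%N) :
  exists (T : finType) (M : matroid T),
    [/\ rank M = r,
        in_U l M
      & (2 ^- 7 * l%:R ^+ 3 : R) `^ ((r%:R - 2) / 2) <= #|hyperplanes M|%:R].
Proof.
have [a [a0 q_le l3_le]] := field_order_near hl.
have [F _ cF] := pPrimePowerField (isT : prime 2) a0.
have k0 : (0 < r.-1./2)%N by lia.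
(* The bound [l + 1] on lines is what [2q <= l + 2] allows; the coloop is present exactly for even
   [r]. *)
have [|M [rM bM hM]] := @many_hyperplanes F _ (~~ odd r) l.+1 k0; first by rewrite cF.
exists _, M; split; first by rewrite rM; lia.
  exact: line_bounded_in_U.
(* Since [10^3 >= 2^7], the base is at least 1, so the exponent [(r - 2) / 2] may be raised to the
   integer [r.-1./2]. *)
have B1 : 1 <= (2 ^- 7 * l%:R ^+ 3 : R).
  rewrite ler_pdivlMl ?exprn_gt0 // mulr1 -!natrX ler_nat.
  by apply: (@leq_trans (10 ^ 3)%N); rewrite // leq_exp2r.
apply: (@le_trans _ _ ((2 ^- 7 * l%:R ^+ 3 : R) `^ (r.-1./2)%:R)).
  apply: ler_powR => //; rewrite ler_pdivrMr // lerBlDr -natrM -natrD ler_nat.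
  by lia.
rewrite powR_mulrn; last by apply: le_trans B1.
apply: (@le_trans _ _ (((2 ^ a * 'C(2 ^ a, 2)) ^ r.-1./2)%N%:R)); last first.
  by rewrite ler_nat -cF.
rewrite natrX; apply: lerXn2r; rewrite ?nnegrE ?ler0n //; first by apply: le_trans B1.
by rewrite ler_pdivrMl ?exprn_gt0 // -!natrX -natrM ler_nat.
Qed.
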